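(* Let $n,m\ge 1$ and let $f\in L^2((0,1)^n)$ and $h\in L^2((0,1)^m)$ be real-valued, with $f$ not a.e. constant and $h$ not a.e. zero, and define $g\in L^2((0,1)^{n+m})$ by $g(x,\xi)=f(x)h(\xi)$ for $x=(x_1,\dots,x_n)\in(0,1)^n$, $\xi\in(0,1)^m$. Fix $i\in\{1,\dots,n\}$. Then $$S^g_{T_{x_i}}=\lambda_{f,h}\,S^f_{T_{x_i}},\qquad \lambda_{f,h}=\frac{\int f(x)^2\,dx-f_0^2}{\int f(x)^2\,dx-\dfrac{f_0^2h_0^2}{\int h(\xi)^2\,d\xi}}.$$ In particular $S^g_{T_{x_i}}\le S^f_{T_{x_i}}$ and $$S^g_{T_{x_i}}\ge\Big(1-\frac{f_0^2}{\int f(x)^2\,dx}\Big)S^f_{T_{x_i}}.$$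
   Context: All integrals are with respect to Lebesgue measure over the unit cubes (equivalently, the inputs are independent and uniformly distributed on $[0,1]$). For a function $\varphi$, $\varphi_0=\int\varphi$ denotes its mean. For a square-integrable function $\varphi$ of variables $(x,y)$ with $x=(x_1,\dots,x_n)$ and $y$ a further (possibly empty) block of variables, write $x_{\sim i}=(x_1,\dots,x_{i-1},x_{i+1},\dots,x_n)$; the total Sobol sensitivity index of $x_i$ for $\varphi$ is $$S^{\varphi}_{T_{x_i}}=\frac{\int\varphi^2\,dx\,dy-\int\big(\int\varphi\,dx_i\big)^2dx_{\sim i}\,dy}{\int\varphi^2\,dx\,dy-\varphi_0^2},$$ defined when $\mathrm{Var}(\varphi)=\int\varphi^2-\varphi_0^2>0$. *)

(* Defs.v *)
From HB Require Import structures.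
From mathcomp Require Import all_boot all_order all_algebra.
From mathcomp Require Import all_classical all_reals all_analysis.
Set Implicit Arguments. Unset Strict Implicit. Unset Printing Implicit Defensive.
Import Order.TTheory GRing.Theory Num.Theory.
Import numFieldNormedType.Exports.
Local Open Scope classical_set_scope.
Local Open Scope ring_scope.

Section Sobol.
Variable R : realType.

(** Integral over the open unit cube (0,1)^n, for functions of n real
    variables x = (x_0,...,x_{n-1}) represented as n.-tuples, defined as the
    iterated Lebesgue integral over (0,1) in each coordinate (by Tonelli/
    Fubini this is the integral w.r.t. the n-dimensional Lebesgue measure
    restricted to the cube, for nonnegative measurable or integrable
    integrands). *)
Fixpoint cube_int (n : nat) : (n.-tuple R -> \bar R) -> \bar R :=
  match n return (n.-tuple R -> \bar R) -> \bar R with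
  | 0 => fun F => F [tuple]
  | n'.+1 => fun F =>
      (\int[@lebesgue_measure R]_(t in `]0%R, 1%R[)
         cube_int (fun x : n'.-tuple R => F (cons_tuple t x)))%E
  end.

Definition cube_measure (n : nat) (A : set (n.-tuple R)) : \bar R :=
  cube_int (fun x => (\1_A x)%:E).

Definition cube_ae (n : nat) (P : n.-tuple R -> Prop) : Prop :=
  exists N : set (n.-tuple R),
    [/\ measurable N, cube_measure N = 0%E &
        forall x, (forall j, tnth x j \in `]0%R, 1%R[) -> ~ P x -> N x].

(** f is a real-valued element of L^2((0,1)^n) (Borel-measurable representative). *)
Definition L2 (n : nat) (f : n.-tuple R -> R) : Prop :=
  measurable_fun setT f /\ (cube_int (fun x => (f x ^+ 2)%:E) < +oo)%E.

Definition set_coord (n : nat) (x : n.-tuple R) (i : 'I_n) (t : R) : n.-tuple R :=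
  [tuple (if j == i then t else tnth x j) | j < n].

Definition int2 (n m : nat) (F : n.-tuple R -> m.-tuple R -> \bar R) : \bar R :=
  cube_int (fun x => cube_int (fun y => F x y)).

Definition sobol_total (n m : nat) (phi : n.-tuple R -> m.-tuple R -> R)
    (i : 'I_n) : R :=
  let I2 := fine (int2 (fun x y => (phi x y ^+ 2)%:E)) in
  let phi0 := fine (int2 (fun x y => (phi x y)%:E)) in
  let inner x y :=
    (\int[@lebesgue_measure R]_(t in `]0%R, 1%R[) (phi (set_coord x i t) y)%:E)%E in
  let J := fine (int2 (fun x y => (inner x y * inner x y)%E)) in
  (I2 - J) / (I2 - phi0 ^+ 2).

End Sobol.

(* Main.v *)
Require Import Defs.
From HB Require Import structures.
From mathcomp Require Import all_boot all_order all_algebra.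
From mathcomp Require Import all_classical all_reals all_analysis.
From mathcomp Require Import measurable_realfun ring lra.
Import Order.TTheory GRing.Theory Num.Theory.
Local Open Scope ring_scope.

(** The iterated integral [cube_int] is the integral against a probability
    measure on the cube (Tonelli and Fubini), so that for [g = f * h] the second
    moment, the mean and the second moment of the partial mean in [x_i] all
    factor: with [J] the last quantity for [f],
    [S^f = (If2 - J) / (If2 - f0^2)] and
    [S^g = (If2 - J) Ih2 / (If2 Ih2 - f0^2 h0^2)].
    The bounds follow from [J <= If2] (Cauchy-Schwarz in [x_i], then Tonelli)
    and [0 <= h0^2 / Ih2 <= 1]. *)

(** * The cube as a probability space: Tonelli and Fubini for [cube_int] *)

Section unit_cube_probability.
Local Open Scope classical_set_scope.
Variable R : realType.

Local Notation mR := (measurableTypeR R).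

(* [measurableTypeR R] and [R] have the same measurable sets but different
   displays; [lebesgue_measure] lives on the former. *)
Definition unif01 : set mR -> \bar R :=
  mrestr (@lebesgue_measure R) (measurable_itv (Interval (BRight 0) (BLeft 1))).

HB.instance Definition _ := Measure.on unif01.

Let unif01_setT : unif01 setT = 1%E.
Proof.
by rewrite /unif01 /mrestr setTI lebesgue_measure_itv/= lte_fin ltr01 oppr0 adde0.
Qed.

HB.instance Definition _ :=
  Measure_isProbability.Build _ _ _ unif01 unif01_setT.

(** The complement of the interval is [unif01]-null. Passing to the whole space gives the form in
    which the product-measure theorems apply. *)
Lemma integral_unif01 (F : mR -> \bar R) : measurable_fun setT F ->
  (\int[@lebesgue_measure R]_(t in `]0%R, 1%R[) F t = \int[unif01]_t F t)%E.
Proof.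
move=> mF; pose D : set mR := `]0%R, 1%R[.
have mD : measurable D by exact: measurable_itv.
transitivity (\int[unif01]_(t in D) F t)%E.
  by apply: eq_measure_integral => A mA AD; rewrite /= /unif01 /mrestr setIidl.
rewrite integral_mkcond; apply: ae_eq_integral => //.
  by apply/(measurable_restrictT _ _).1 => //; exact: measurable_funTS.
exists (~` D); split.
- exact: measurableC.
- by rewrite /= /unif01 /mrestr setICl measure0.
- move=> t /= /not_implyP[_]; rewrite patchE; case: ifPn => //.
  by rewrite notin_setE.
Qed.

(** Tonelli gives measurability for the positive and negative parts separately, and a difference of
    measurable extended-real functions is measurable even where it reads [+oo - +oo]. Hence no
    integrability is assumed. *)
Lemma measurable_fun_integral_param d d' (T : measurableType d)
    (T' : measurableType d') (P : {sigma_finite_measure set T' -> \bar R})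
    (F : T * T' -> \bar R) :
  measurable_fun setT F -> measurable_fun setT (fun t => \int[P]_s F (t, s))%E.
Proof.
move=> mF.
rewrite (_ : (fun t => _) = (fun t => \int[P]_s F^\+ (t, s))%E \-
                            (fun t => \int[P]_s F^\- (t, s))%E)%E; last first.
  apply/funext => t; rewrite [LHS]integralE.
  by under eq_integral do rewrite funepos_comp/=;
     under [X in (_ - X)%E = _]eq_integral do rewrite funeneg_comp/=.
apply: emeasurable_funB; apply: measurable_fun_fubini_tonelli_F => //.
- exact: measurable_funepos.
- exact: measurable_funeneg.
Qed.

Lemma measurable_cons_pair n :
  measurable_fun setT (fun p : mR * n.-tuple R => cons_tuple p.1 p.2).
Proof. exact: measurable_cons measurable_fst measurable_snd. Qed.

(** Named so that it can carry the measurable-function structure that [distribution] expects. *)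
Definition cons_pair n (p : mR * n.-tuple R) : n.+1.-tuple R :=
  cons_tuple p.1 p.2.

HB.instance Definition _ n := isMeasurableFun.Build _ _ _ _ (@cons_pair n)
  (measurable_cons_pair n).

(** The law of [n] independent uniform variables, built by the same recursion as [cube_int] so that
    inductions peel the first coordinate off both. *)
Fixpoint cube_prob n : probability (n.-tuple R) R :=
  match n with
  | 0 => dirac [tuple]
  | n'.+1 => distribution (unif01 \x cube_prob n')%E (@cons_pair n')
  end.

(** The parameter space is arbitrary because the induction absorbs the first coordinate into it,
    replacing [T] by [T * mR]. *)
Lemma measurable_fun_cube_int d (T : measurableType d) n
    (F : T -> n.-tuple R -> \bar R) :
  measurable_fun setT (fun p => F p.1 p.2) ->
  measurable_fun setT (fun t => cube_int (F t)).
Proof.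
elim: n d T F => [|n IH] d T F mF /=.
  exact: (measurableT_comp mF (measurable_pair2 _)).
have mG : measurable_fun [set: T * mR]
    (fun p => cube_int (fun x => F p.1 (cons_tuple p.2 x))).
  apply: (IH _ _ (fun p x => F p.1 (cons_tuple p.2 x))).
  apply: (@measurableT_comp _ _ _ _ _ _ (fun p => F p.1 p.2) _
    (fun q : (T * mR) * n.-tuple R => (q.1.1, cons_tuple q.1.2 q.2)) mF).
  apply/measurable_fun_pairP; split.
    exact: (measurableT_comp measurable_fst measurable_fst).
  apply: measurable_cons; last exact: measurable_snd.
  exact: (measurableT_comp measurable_snd measurable_fst).
under eq_fun => t.
  rewrite integral_unif01; last first.
    exact: (measurableT_comp mG (measurable_pair1 _)).
  over.
exact: measurable_fun_integral_param mG.
Qed.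

Lemma ge0_cube_intE n (F : n.-tuple R -> \bar R) :
  measurable_fun setT F -> (forall x, 0 <= F x)%E ->
  cube_int F = (\int[cube_prob n]_x F x)%E.
Proof.
elim: n F => [|n IH] F mF F0.
  by rewrite [RHS]integral_dirac// diracT mul1e.
have mFc : measurable_fun [set: mR * n.-tuple R] (F \o @cons_pair n).
  exact: (measurableT_comp mF (measurable_cons_pair n)).
have mFt t : measurable_fun setT (fun x : n.-tuple R => F (cons_tuple t x)).
  exact: (measurableT_comp mFc (measurable_pair1 t)).
rewrite [RHS]ge0_integral_distribution// fubini_tonelli1//=.
rewrite -integral_unif01; last first.
  exact: measurable_fun_integral_param mFc.
by apply: eq_integral => t _; rewrite IH.
Qed.

(** Fubini by induction. Slices of an integrable function are integrable only almost everywhere, so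
    the two inner integrals are compared almost everywhere; this requires [measurable_fun_cube_int],
    which also covers the bad slices. *)
Lemma integrable_cube_intE n (F : n.-tuple R -> \bar R) :
  (cube_prob n).-integrable setT F ->
  cube_int F = (\int[cube_prob n]_x F x)%E.
Proof.
elim: n F => [|n IH] F iF; have mF := measurable_int _ iF.
  by rewrite [RHS]integral_dirac// diracT mul1e.
have mFc : measurable_fun [set: mR * n.-tuple R] (F \o @cons_pair n).
  exact: (measurableT_comp mF (measurable_cons_pair n)).
have iFc : (unif01 \x cube_prob n)%E.-integrable setT (F \o @cons_pair n).
  apply/integrableP; split => //.
  move/integrableP : iF => [_]; rewrite ge0_integral_distribution//.
  exact: measurableT_comp.
rewrite [RHS]integral_distribution// -integral12_prod_meas1//.
have mG : measurable_fun [set: mR]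
    (fun t => cube_int (fun x : n.-tuple R => F (cons_tuple t x))).
  exact: (@measurable_fun_cube_int _ mR n (fun t x => F (cons_tuple t x))).
rewrite /= integral_unif01//; apply: ae_eq_integral => //.
  exact: measurable_fubini_F iFc.
(* Outside this null set the slice is integrable and [IH] applies. *)
have [N [mN N0 sN]] := ae_integrable1 iFc.
exists N; split => // t /= /not_implyP[_ tF]; apply: sN => /=.
by apply: contra_not tF => iFt; rewrite IH.
Qed.

Lemma cube_measureE n (A : set (n.-tuple R)) : measurable A ->
  cube_measure A = cube_prob n A.
Proof.
move=> mA; rewrite /cube_measure ge0_cube_intE; last 2 first.
- by apply/measurable_EFinP; exact: measurable_indic.
- by move=> x; rewrite lee_fin.
by rewrite integral_indic// setIT.
Qed.

Lemma cube_int_eq0_ae n (F : n.-tuple R -> R) : measurable_fun setT F ->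
  (forall x, 0 <= F x) -> cube_int (fun x => (F x)%:E) = 0%E ->
  cube_ae (fun x => F x = 0).
Proof.
move=> mF F0; have mEF := (measurable_EFinP _ _).2 mF.
rewrite ge0_cube_intE => // intF0.
have /(ae_eq_integral_abs (cube_prob n) measurableT mEF)[N [mN N0 sN]] :
    (\int[cube_prob n]_x `|(F x)%:E| = 0)%E.
  rewrite -intF0; apply: eq_integral => x _.
  by rewrite gee0_abs// lee_fin.
exists N; split => //; first by rewrite cube_measureE.
move=> x _ Fx; apply: sN => /= /(_ I) [].
exact: Fx.
Qed.

End unit_cube_probability.

(** * Square-integrable functions on a probability space *)

Section square_integrable.
Local Open Scope classical_set_scope.
Set Implicit Arguments.
Unset Strict Implicit.
Context d (T : measurableType d) (R : realType) (P : probability T R).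
Variable f : T -> R.
Hypothesis mf : measurable_fun setT f.
Hypothesis f2_fin : (\int[P]_x (f x ^+ 2)%:E < +oo)%E.

Lemma integrable_sqr : P.-integrable setT (fun x => (f x ^+ 2)%:E).
Proof.
apply/integrableP; split.
  by apply/measurable_EFinP; exact: measurable_funX.
by under eq_integral do rewrite gee0_abs ?lee_fin ?sqr_ge0//.
Qed.

Lemma integrable_of_sqr : P.-integrable setT (EFin \o f).
Proof.
have i1 : P.-integrable setT (cst 1%E) by exact: finite_measure_integrable_cst.
apply: (le_integrable measurableT _ _ (integrableD measurableT integrable_sqr i1)).
  exact/measurable_EFinP.
move=> x _ /=; rewrite lee_fin [leRHS]ger0_norm ?addr_ge0 ?sqr_ge0//.
(* These squares give [|y| <= y ^+ 2 + 1] for [y = f x]. *)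
have := sqr_ge0 (f x - 1); have := sqr_ge0 (f x + 1); have := sqr_ge0 (f x).
by rewrite ler_norml; move: (f x) => y; nra.
Qed.

(** Writing the variance as the integral of a square yields both its nonnegativity and, when it
    vanishes, that [f] is a.e. constant. *)
Lemma integral_sqr_center (m := fine (\int[P]_x (f x)%:E)%E) :
  (\int[P]_x ((f x - m) ^+ 2)%:E)%E =
  (fine (\int[P]_x (f x ^+ 2)%:E)%E - m ^+ 2)%:E.
Proof.
have if2 := integrable_sqr; have if1 := integrable_of_sqr.
under eq_integral => x _.
  rewrite (_ : (f x - m) ^+ 2 = f x ^+ 2 + ((- (2 * m)) * f x + m ^+ 2)); last by ring.
  rewrite !EFinD [((- (2 * m)) * f x)%:E]EFinM; over.
have im : P.-integrable setT (cst (m ^+ 2)%:E) by exact: finite_measure_integrable_cst.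
have izf : P.-integrable setT (fun x => (- (2 * m))%:E * (f x)%:E)%E.
  exact: integrableZl.
rewrite integralD//; last exact: integrableD.
rewrite integralD// integralZl// integral_cst//.
rewrite [X in (_ + (_ + _ * X))%E](probability_setT P).
rewrite mule1 -(fineK (integrable_fin_num measurableT if2)).
rewrite -(fineK (integrable_fin_num measurableT if1)) -!EFinM -!EFinD /=.
by congr EFin; rewrite -/m /=; ring.
Qed.

End square_integrable.

(** * Squares of possibly divergent integrals *)

Section sqr_integral.
Local Open Scope classical_set_scope.
Set Implicit Arguments.
Unset Strict Implicit.
Context d (T : measurableType d) (R : realType) (P : probability T R).

(** Cauchy-Schwarz against the constant 1, read off from nonnegativity of the variance. An infinite
    right-hand side is allowed, since individual slices of an L2 function need not be
    square-integrable. *)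
Lemma sqr_integral_le (f : T -> R) : measurable_fun setT f ->
  ((\int[P]_x (f x)%:E) * (\int[P]_x (f x)%:E) <= \int[P]_x (f x ^+ 2)%:E)%E.
Proof.
move=> mf; have [->|f2oo] := eqVneq (\int[P]_x (f x ^+ 2)%:E)%E +oo%E.
  exact: leey.
rewrite -ltey in f2oo.
have if2 := integrable_sqr mf f2oo; have if1 := integrable_of_sqr mf f2oo.
have := integral_sqr_center mf f2oo.
set m := fine _ => /esym mE.
have : (0 <= \int[P]_x ((f x - m) ^+ 2)%:E)%E.
  by apply: integral_ge0 => x _; rewrite lee_fin sqr_ge0.
rewrite -mE lee_fin subr_ge0 => {mE}.
rewrite -(fineK (integrable_fin_num measurableT if2)).
rewrite -(fineK (integrable_fin_num measurableT if1)) -EFinM lee_fin.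
by rewrite -/m -expr2.
Qed.

(* No integrability is needed: the junk value [+oo - +oo = -oo] of a divergent
   integral becomes harmless after squaring. *)
Lemma sqr_integralZr (k : R) (f : T -> R) : measurable_fun setT f ->
  ((\int[P]_x (f x * k)%:E) * (\int[P]_x (f x * k)%:E) =
   (\int[P]_x (f x)%:E * \int[P]_x (f x)%:E) * (k ^+ 2)%:E)%E.
Proof.
(* Here [a] and [b] stand for the integrals of the positive and negative parts of [f]. *)
have sqr (r : R) (a b : \bar R) : r != 0 -> (0 <= a)%E -> (0 <= b)%E ->
    ((`|r|%:E * a - `|r|%:E * b) * (`|r|%:E * a - `|r|%:E * b) =
     ((a - b) * (a - b)) * (r ^+ 2)%:E)%E.
  move=> r0; have nr0 : (0%:E < `|r|%:E)%E by rewrite lte_fin normr_gt0.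
  have r20 : (0%:E < (r ^+ 2)%:E)%E by rewrite lte_fin exprn_even_gt0.
  move: a b => [a| |] [b| |]//= _ _.
  - by rewrite -(real_normK (num_real r)); congr EFin; ring.
  - by rewrite gt0_muley// !addeNy mulNyNy gt0_mulye.
  - by rewrite gt0_muley// !addye// mulyy gt0_mulye.
  - by rewrite gt0_muley// !addeNy mulNyNy gt0_mulye.
(* A negative [k] exchanges the positive and negative parts; squaring hides the exchange. *)
have sqrC (a b : \bar R) : (0 <= a)%E -> (0 <= b)%E ->
    ((a - b) * (a - b) = (b - a) * (b - a))%E.
  move: a b => [a| |] [b| |]//= _ _; rewrite ?addeNy ?addye// ?mulNyNy ?mulyy//.
  by congr EFin; ring.
move=> mf; under eq_integral do rewrite mulrC EFinM.
have [->|k0] := eqVneq k 0.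
  by rewrite expr0n/= mule0 integral0_eq ?mule0// => x _; rewrite mul0e.
rewrite [X in (_ = X * X * _)%E]integralE.
have mp : measurable_fun setT ((fun x => (f x)%:E)^\+)%E.
  exact/measurable_funepos/measurable_EFinP.
have mn : measurable_fun setT ((fun x => (f x)%:E)^\-)%E.
  exact/measurable_funeneg/measurable_EFinP.
have p0 : (0 <= \int[P]_x ((fun x => (f x)%:E)^\+ x))%E by exact: integral_ge0.
have n0 : (0 <= \int[P]_x ((fun x => (f x)%:E)^\- x))%E by exact: integral_ge0.
rewrite -sqr// integralE; have [kge|klt] := leP 0 k.
  rewrite ge0_funeposM// ge0_funenegM// !ge0_integralZl// ger0_norm//.
rewrite le0_funeposM ?le0_funenegM ?ltW// !ge0_integralZl//;
  rewrite ?lee_fin ?oppr_ge0 ?ltW//.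
have -> : (- k%:E = `|k|%:E)%E by rewrite ltr0_norm.
by rewrite !sqr// sqrC.
Qed.

End sqr_integral.

(** * Averaging over one coordinate, and product integrands *)

Section coordinate.
Local Open Scope classical_set_scope.
Set Implicit Arguments.
Unset Strict Implicit.
Variable R : realType.
Local Notation mR := (measurableTypeR R).

Lemma set_coord_cons0 n (s t : R) (x : n.-tuple R) :
  set_coord (cons_tuple s x) ord0 t = cons_tuple t x.
Proof.
apply: eq_from_tnth => j; rewrite tnth_mktuple.
by case: (unliftP ord0 j) => [k|] ->; rewrite ?eqxx// !tnthS.
Qed.

Lemma set_coord_consS n (s t : R) (x : n.-tuple R) (i : 'I_n) :
  set_coord (cons_tuple s x) (lift ord0 i) t = cons_tuple s (set_coord x i t).
Proof.
apply: eq_from_tnth => j; rewrite tnth_mktuple.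
case: (unliftP ord0 j) => [k|] ->; last by rewrite !tnth0.
by rewrite !tnthS tnth_mktuple (inj_eq lift_inj).
Qed.

Lemma measurable_set_coord n (i : 'I_n) :
  measurable_fun setT (fun p : n.-tuple R * mR => set_coord p.1 i p.2).
Proof.
apply/measurable_fun_tnthP => j; have [->|ji] := eqVneq j i.
  rewrite (_ : _ \o _ = snd); first exact: measurable_snd.
  by apply/funext => p /=; rewrite tnth_mktuple eqxx.
rewrite (_ : _ \o _ = (@tnth _ R ^~ j) \o fst).
  exact: (measurableT_comp (measurable_tnth j) measurable_fst).
by apply/funext => p /=; rewrite tnth_mktuple (negbTE ji).
Qed.

(** The partial mean no longer depends on coordinate [i], so integrating over that coordinate again
    contributes only the factor 1. The induction reaches the coordinate [i], where Tonelli restores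
    the order of integration. *)
Lemma cube_int_set_coord n (F : n.-tuple R -> \bar R) (i : 'I_n) :
  measurable_fun setT F -> (forall x, 0 <= F x)%E ->
  cube_int (fun x => \int[@lebesgue_measure R]_(t in `]0%R, 1%R[)
                       F (set_coord x i t))%E = cube_int F.
Proof.
elim: n F i => [F []//|n IH] F i mF F0.
have mFc : measurable_fun [set: mR * n.-tuple R] (F \o @cons_pair R n).
  exact: (measurableT_comp mF (measurable_cons_pair R n)).
case: (unliftP ord0 i) => [k|] -> /=.
  apply: eq_integral => s _; under eq_fun do under eq_integral do rewrite set_coord_consS.
  rewrite (IH (fun x => F (cons_tuple s x)))//.
  exact: (measurableT_comp mFc (measurable_pair1 s)).
(* Case where [i] is the first coordinate: the integrand becomes constant in the outer variable. *)
under eq_integral do under eq_fun do under eq_integral do rewrite set_coord_cons0.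
rewrite integral_unif01; last exact: measurable_cst.
rewrite integral_cst// [X in (_ * X)%E](probability_setT (unif01 R)) mule1.
under eq_fun => x.
  rewrite (integral_unif01 _ (fun t => F (cons_tuple t x))); last first.
    exact: (measurableT_comp mFc (measurable_pair2 x)).
  over.
rewrite ge0_cube_intE; last 2 first.
- exact: (@measurable_fun_fubini_tonelli_G _ _ mR _ R (unif01 R)
    (F \o @cons_pair R n) mFc (fun=> F0 _)).
- by move=> x; apply: integral_ge0.
rewrite -(@fubini_tonelli _ _ mR _ R (unif01 R) (cube_prob R n)
  (F \o @cons_pair R n))//=.
rewrite -integral_unif01; last exact: measurable_fun_integral_param mFc.
apply: eq_integral => t _; rewrite ge0_cube_intE//.
exact: (measurableT_comp mFc (measurable_pair1 t)).
Qed.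

Lemma measurable_fun_int_coord n (f : n.-tuple R -> R) (i : 'I_n) :
  measurable_fun setT f ->
  measurable_fun setT (fun x => \int[@lebesgue_measure R]_(t in `]0%R, 1%R[)
                                  (f (set_coord x i t))%:E)%E.
Proof.
move=> mf.
have mF : measurable_fun [set: n.-tuple R * mR]
    (fun p => (f (set_coord p.1 i p.2))%:E).
  apply/measurable_EFinP.
  exact: (measurableT_comp mf (measurable_set_coord i)).
under eq_fun => x.
  rewrite (integral_unif01 _ (fun t => (f (set_coord x i t))%:E)); last first.
    exact: (measurableT_comp mF (measurable_pair1 x)).
  over.
exact: measurable_fun_integral_param mF.
Qed.

(** Cauchy-Schwarz holds on every slice, and [cube_int_set_coord] applied to the square of [f]
    removes the averaging on the right. *)
Lemma cube_int_sqr_int_coord_le n (f : n.-tuple R -> R) (i : 'I_n)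
    (F := fun x => (\int[@lebesgue_measure R]_(t in `]0%R, 1%R[)
                     (f (set_coord x i t))%:E)%E) :
  measurable_fun setT f ->
  (cube_int (fun x => F x * F x) <= cube_int (fun x => (f x ^+ 2)%:E))%E.
Proof.
move=> mf; have mF := measurable_fun_int_coord i mf.
have mf2 : measurable_fun setT (fun x => (f x ^+ 2)%:E).
  by apply/measurable_EFinP; exact: measurable_funX.
have mft x : measurable_fun [set: mR] (fun t => f (set_coord x i t)).
  exact: (measurableT_comp mf (measurableT_comp (measurable_set_coord i)
    (measurable_pair1 x))).
have mft2 x : measurable_fun [set: mR] (fun t => (f (set_coord x i t) ^+ 2)%:E).
  by apply/measurable_EFinP; exact: measurable_funX.
rewrite -(cube_int_set_coord i mf2); last by move=> x; rewrite lee_fin sqr_ge0.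
have mI : measurable_fun setT (fun x => \int[@lebesgue_measure R]_(t in `]0%R, 1%R[)
    (f (set_coord x i t) ^+ 2)%:E)%E.
  apply: (measurable_fun_int_coord i (f := fun x => f x ^+ 2)).
  exact: measurable_funX.
rewrite !ge0_cube_intE//; first last.
- by move=> x; rewrite -expe2 sqre_ge0.
- exact: emeasurable_funM.
- by move=> x; apply: integral_ge0 => t _; rewrite lee_fin sqr_ge0.
apply: ge0_le_integral => //.
- by move=> x _; rewrite -expe2 sqre_ge0.
- exact: emeasurable_funM.
- move=> x _; rewrite /F !integral_unif01//; last exact/measurable_EFinP.
  exact: sqr_integral_le.
Qed.

Lemma ge0_int2M n m (K : n.-tuple R -> \bar R) (H : m.-tuple R -> \bar R) :
  measurable_fun setT K -> (forall x, 0 <= K x)%E ->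
  measurable_fun setT H -> (forall y, 0 <= H y)%E ->
  int2 (fun x y => K x * H y)%E = (cube_int K * cube_int H)%E.
Proof.
move=> mK K0 mH H0; rewrite /int2.
have cH : (0 <= cube_int H)%E by rewrite ge0_cube_intE//; exact: integral_ge0.
under eq_fun => x.
  rewrite ge0_cube_intE; last 2 first.
  - exact: measurable_funeM.
  - by move=> y; apply: mule_ge0.
  rewrite ge0_integralZl// -ge0_cube_intE// muleC; over.
rewrite ge0_cube_intE; last 2 first.
- exact: measurable_funeM.
- by move=> x; apply: mule_ge0.
by rewrite ge0_integralZl// -ge0_cube_intE// muleC.
Qed.

Lemma integrable_int2M n m (f : n.-tuple R -> R) (h : m.-tuple R -> R) :
  (cube_prob R n).-integrable setT (EFin \o f) ->
  (cube_prob R m).-integrable setT (EFin \o h) ->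
  int2 (fun x y => (f x * h y)%:E) =
  (cube_int (fun x => (f x)%:E) * cube_int (fun y => (h y)%:E))%E.
Proof.
move=> fi hi; rewrite /int2.
(* Finiteness makes the integral of [h] a real scalar, which can leave the signed outer integral. *)
have hfin : cube_int (fun y => (h y)%:E) \is a fin_num.
  by rewrite integrable_cube_intE//; exact: integrable_fin_num.
under eq_fun => x.
  rewrite integrable_cube_intE; last first.
    by under eq_fun do rewrite EFinM; exact: integrableZl.
  under eq_integral do rewrite EFinM.
  rewrite integralZl// -(integrable_cube_intE _ _ _ hi) muleC -(fineK hfin); over.
rewrite integrable_cube_intE; last exact: integrableZl.
rewrite integralZl// -(integrable_cube_intE _ _ _ fi).
by rewrite -[in RHS](fineK hfin) muleC.
Qed.

End coordinate.

(** * Moments of L2 functions on the cube, and strict positivity *)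

Section L2_cube.
Set Implicit Arguments.
Unset Strict Implicit.
Variables (R : realType) (n : nat) (f : n.-tuple R -> R).
Hypothesis f_L2 : L2 f.

Let mf : measurable_fun setT f. Proof. by case: f_L2. Qed.

Lemma measurable_fun_sqr : measurable_fun setT (fun x => (f x ^+ 2)%:E).
Proof. by apply/measurable_EFinP; exact: measurable_funX. Qed.

Lemma cube_int_sqrE :
  cube_int (fun x => (f x ^+ 2)%:E) = (\int[cube_prob R n]_x (f x ^+ 2)%:E)%E.
Proof.
apply: ge0_cube_intE; first exact: measurable_fun_sqr.
by move=> x; rewrite lee_fin sqr_ge0.
Qed.

Let f2_fin : (\int[cube_prob R n]_x (f x ^+ 2)%:E < +oo)%E.
Proof. by rewrite -cube_int_sqrE; case: f_L2. Qed.

Lemma L2_integrable : (cube_prob R n).-integrable setT (EFin \o f).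
Proof. exact: integrable_of_sqr. Qed.

Lemma cube_int_sqr_fin_num : cube_int (fun x => (f x ^+ 2)%:E) \is a fin_num.
Proof.
by rewrite cube_int_sqrE; exact: integrable_fin_num (integrable_sqr mf f2_fin).
Qed.

Let f0 := fine (cube_int (fun x => (f x)%:E)).
Let If2 := fine (cube_int (fun x => (f x ^+ 2)%:E)).

Let int_center : cube_int (fun x => ((f x - f0) ^+ 2)%:E) = (If2 - f0 ^+ 2)%:E.
Proof.
rewrite ge0_cube_intE; last 2 first.
- apply/measurable_EFinP; apply: measurable_funX.
  exact: measurable_funB.
- by move=> x; rewrite lee_fin sqr_ge0.
rewrite /f0 /If2 cube_int_sqrE (integrable_cube_intE _ _ _ L2_integrable).
exact: integral_sqr_center.
Qed.

Lemma sqr_mean_le : f0 ^+ 2 <= If2.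
Proof.
rewrite -subr_ge0 -lee_fin -int_center ge0_cube_intE; last 2 first.
- apply/measurable_EFinP; apply: measurable_funX.
  exact: measurable_funB.
- by move=> x; rewrite lee_fin sqr_ge0.
by apply: integral_ge0 => x _; rewrite lee_fin sqr_ge0.
Qed.

Lemma cube_ae_sqr0 (g : n.-tuple R -> R) c : cube_ae (fun x => (g x - c) ^+ 2 = 0) ->
  cube_ae (fun x => g x = c).
Proof.
move=> [N [mN N0 sN]]; exists N; split => // x x01 gxc; apply: sN => //.
by move/eqP; rewrite sqrf_eq0 subr_eq0 => /eqP.
Qed.

(** Zero variance would make the square of [f - f0] integrate to 0, hence [f = f0] almost
    everywhere. *)
Lemma variance_gt0 : ~ (exists c, cube_ae (fun x => f x = c)) -> 0 < If2 - f0 ^+ 2.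
Proof.
move=> fc; rewrite lt_neqAle subr_ge0 sqr_mean_le andbT; apply/eqP => V0.
apply: fc; exists f0; apply: cube_ae_sqr0; apply: cube_int_eq0_ae.
- by apply: measurable_funX; exact: measurable_funB.
- by move=> x; exact: sqr_ge0.
- by rewrite int_center -V0.
Qed.

Lemma sqr_int_gt0 : ~ cube_ae (fun x => f x = 0) -> 0 < If2.
Proof.
move=> fN0; have : 0 <= If2 by apply: le_trans sqr_mean_le; exact: sqr_ge0.
rewrite le_eqVlt => /predU1P[If20|//]; case: fN0.
(* Used with [c = 0], hence the [subr0] below. *)
apply: cube_ae_sqr0; apply: cube_int_eq0_ae.
- by apply: measurable_funX; exact: measurable_funB.
- by move=> x; exact: sqr_ge0.
- under eq_fun do rewrite subr0.
  by rewrite -(fineK cube_int_sqr_fin_num) -/If2 -If20.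
Qed.

End L2_cube.

(** * The scaling identity and the two bounds *)

Theorem theorem1 (R : realType) (n m : nat) (f : n.-tuple R -> R)
    (h : m.-tuple R -> R) (i : 'I_n) :
  (1 <= n)%N -> (1 <= m)%N ->
  L2 f -> L2 h ->
  ~ (exists c : R, cube_ae (fun x => f x = c)) ->
  ~ cube_ae (fun xi => h xi = 0) ->
  let f0 := fine (cube_int (fun x => (f x)%:E)) in
  let h0 := fine (cube_int (fun xi => (h xi)%:E)) in
  let If2 := fine (cube_int (fun x => (f x ^+ 2)%:E)) in
  let Ih2 := fine (cube_int (fun xi => (h xi ^+ 2)%:E)) in
  let lambda := (If2 - f0 ^+ 2) / (If2 - f0 ^+ 2 * h0 ^+ 2 / Ih2) in
  let Sf := sobol_total (fun (x : n.-tuple R) (_ : 0.-tuple R) => f x) i in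
  let Sg := sobol_total (fun x xi => f x * h xi) i in
  [/\ Sg = lambda * Sf,
      Sg <= Sf &
      (1 - f0 ^+ 2 / If2) * Sf <= Sg].
Proof.
move=> _ _ f_L2 h_L2 fc hN0 f0 h0 If2 Ih2 lambda Sf Sg.
have [mf f2fin] := f_L2; have [mh h2fin] := h_L2.
have V0 : 0 < If2 - f0 ^+ 2 := variance_gt0 f_L2 fc.
have B0 : 0 < Ih2 := sqr_int_gt0 h_L2 hN0.
have hB : h0 ^+ 2 <= Ih2 := sqr_mean_le h_L2.
pose F x := (\int[@lebesgue_measure R]_(t in `]0%R, 1%R[%classic)
               (f (set_coord x i t))%:E)%E.
have mF : measurable_fun setT F := measurable_fun_int_coord i mf.
pose Je := cube_int (fun x => F x * F x)%E.
have F20 x : (0 <= F x * F x)%E by rewrite -expe2 sqre_ge0.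
have mF2 : measurable_fun setT (fun x => F x * F x)%E by exact: emeasurable_funM.
have Jle : (Je <= cube_int (fun x => (f x ^+ 2)%:E))%E := cube_int_sqr_int_coord_le i mf.
have J0 : (0 <= Je)%E by rewrite /Je ge0_cube_intE//; exact: integral_ge0.
have Jfin : Je \is a fin_num by rewrite ge0_fin_numE// (le_lt_trans Jle).
pose J := fine Je.
have JI : J <= If2 by apply: fine_le => //; exact: cube_int_sqr_fin_num.
(* Holds by computation: on [0.-tuple R], [cube_int] is evaluation at the empty tuple. *)
have SfE : Sf = (If2 - J) / (If2 - f0 ^+ 2) by [].
have I2g : fine (int2 (fun x y => ((f x * h y) ^+ 2)%:E)) = If2 * Ih2.
  under eq_fun do under eq_fun do rewrite exprMn EFinM.
  rewrite (@ge0_int2M R n m (fun x => (f x ^+ 2)%:E) (fun y => (h y ^+ 2)%:E));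
    try exact: measurable_fun_sqr; try by move=> x; rewrite lee_fin sqr_ge0.
  by rewrite fineM//; exact: cube_int_sqr_fin_num.
have g0 : fine (int2 (fun x y => (f x * h y)%:E)) = f0 * h0.
  have fi := L2_integrable f_L2; have hi := L2_integrable h_L2.
  rewrite integrable_int2M// fineM// integrable_cube_intE//;
    exact: integrable_fin_num.
have Jg : fine (int2 (fun x y =>
      (\int[@lebesgue_measure R]_(t in `]0%R, 1%R[%classic)
         (f (set_coord x i t) * h y)%:E) *
      (\int[@lebesgue_measure R]_(t in `]0%R, 1%R[%classic)
         (f (set_coord x i t) * h y)%:E))%E) = J * Ih2.
  (* By [sqr_integralZr] the factorisation holds at every point, including slices where [f] is not
     integrable, so no exceptional set arises. *)
  have -> : (fun x y =>
      (\int[@lebesgue_measure R]_(t in `]0%R, 1%R[%classic)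
         (f (set_coord x i t) * h y)%:E) *
      (\int[@lebesgue_measure R]_(t in `]0%R, 1%R[%classic)
         (f (set_coord x i t) * h y)%:E))%E =
      (fun x y => (F x * F x) * (h y ^+ 2)%:E)%E.
    apply/funext => x; apply/funext => y; rewrite /F.
    have mft : measurable_fun [set: measurableTypeR R] (fun t => f (set_coord x i t)).
      exact: (measurableT_comp mf (measurableT_comp (measurable_set_coord i)
        (measurable_pair1 x))).
    rewrite !integral_unif01 ?sqr_integralZr//; first exact/measurable_EFinP.
    by apply/measurable_EFinP; exact: measurable_funM.
  rewrite (@ge0_int2M R n m (fun x => F x * F x)%E (fun y => (h y ^+ 2)%:E))//;
    try exact: measurable_fun_sqr; try by move=> x; rewrite lee_fin sqr_ge0.
  by rewrite fineM//; exact: cube_int_sqr_fin_num.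
have SgE : Sg = (If2 * Ih2 - J * Ih2) / (If2 * Ih2 - (f0 * h0) ^+ 2).
  by rewrite /Sg /sobol_total I2g g0 Jg.
have Sf0 : 0 <= Sf by rewrite SfE; apply: divr_ge0; [rewrite subr_ge0 | exact: ltW].
have If20 : 0 < If2 by rewrite (le_lt_trans (sqr_ge0 f0))// -subr_gt0.
pose D := If2 - f0 ^+ 2 * h0 ^+ 2 / Ih2.
have q0 : 0 <= h0 ^+ 2 / Ih2 by rewrite divr_ge0 ?sqr_ge0// ltW.
have q1 : h0 ^+ 2 / Ih2 <= 1 by rewrite ler_pdivrMr// mul1r.
have f00 := sqr_ge0 f0.
(* Reassociating exposes the ratio [h0 ^+ 2 / Ih2], which lies in [0, 1]. The resulting bounds
   [If2 - f0 ^+ 2 <= D <= If2] on the denominator of [lambda] give the upper and lower estimates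
   respectively. *)
have VD : If2 - f0 ^+ 2 <= D by rewrite /D -mulrA; nra.
have DI : D <= If2 by rewrite /D -mulrA; nra.
have D0 : 0 < D := lt_le_trans V0 VD.
have SgL : Sg = lambda * Sf.
  have -> : lambda = (If2 - f0 ^+ 2) / D by [].
  have DE : If2 * Ih2 - (f0 * h0) ^+ 2 = D * Ih2.
    by rewrite /D; field; rewrite gt_eqF.
  rewrite SgE SfE DE; field.
  by rewrite !gt_eqF.
split => //; rewrite SgL.
- by rewrite ler_piMl// ler_pdivrMr// mul1r.
- apply: ler_wpM2r => //.
  have -> : 1 - f0 ^+ 2 / If2 = (If2 - f0 ^+ 2) / If2 by field; rewrite gt_eqF.
  by apply: ler_wpM2l; [exact: ltW | rewrite lef_pV2// posrE].
Qed.
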